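(* There exist a universal constant $c\ge 1$ and a (possibly randomized) single-sample online algorithm $\mathsf{ALG}$ for the combinatorial allocation problem with the following property. For all $n,m\ge 1$ and every product distribution $D=D_1\times\dots\times D_n$ over profiles of XOS (in particular, submodular) valuations on the item set $[m]$, if the sample profile $\mathbf{s}=(s_1,\dots,s_n)\sim D$ and the actual valuation profile $\mathbf{v}=(v_1,\dots,v_n)\sim D$ are independent, then $$\mathbb{E}\Big[\sum_{i=1}^n v_i\big(\mathsf{ALG}_i(\mathbf{v};\mathbf{s})\big)\Big]\;\ge\;\frac1c\cdot \mathbb{E}\Big[\max_{(A_1,\dots,A_n)}\sum_{i=1}^n v_i(A_i)\Big],$$ where the maximum is over all allocations, i.e. tuples of pairwise disjoint sets $A_1,\dots,A_n\subseteq[m]$.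
   Context: Valuations: a valuation is a function $v:2^{[m]}\to\mathbb{R}_{\ge0}$ that is normalized ($v(\emptyset)=0$) and monotone ($v(S)\le v(T)$ for $S\subseteq T$). $v$ is XOS if there is a finite collection of additive functions $a_\ell:2^{[m]}\to\mathbb{R}_{\ge0}$, $a_\ell(B)=\sum_{j\in B}a_\ell(j)$ with $a_\ell(j)\ge0$, such that $v(B)=\max_\ell a_\ell(B)$ for all $B\subseteq[m]$. $v$ is submodular if $v(A\cup\{j\})-v(A)\ge v(B\cup\{j\})-v(B)$ for all $A\subseteq B\subseteq[m]$, $j\notin B$; (monotone, normalized) submodular valuations are XOS. Problem: $m$ indivisible items are available from the start; buyers $1,\dots,n$ arrive in this fixed, known order. The distributions $D_i$ are unknown to the algorithm. A single-sample online algorithm sees the sample profile $\mathbf{s}$ in advance (one sample $s_i\sim D_i$ per buyer). When buyer $i$ arrives, $v_i$ is revealed, and the algorithm must immediately and irrevocably allocate to $i$ a subset $\mathsf{ALG}_i(\mathbf{v};\mathbf{s})$ of the still unallocated items, based only on $\mathbf{s}$, $v_1,\dots,v_i$ and its internal randomness. Expectations are over $\mathbf{s}$, $\mathbf{v}$ and the algorithm's randomness. *)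

(* Defs.v *)
From HB Require Import structures.
From mathcomp Require Import all_boot all_order all_algebra.
From mathcomp Require Import all_classical all_reals all_analysis.

Set Implicit Arguments.
Unset Strict Implicit.
Unset Printing Implicit Defensive.

Import Order.TTheory GRing.Theory Num.Theory.

Local Open Scope classical_set_scope.
Local Open Scope ring_scope.

(* The item set [m] is 'I_m and a bundle of items is an element of
   {set 'I_m}. *)
Record valuation (R : realType) (m : nat) := Valuation {
  val_fun :> {set 'I_m} -> R;
  val_ge0 : forall S : {set 'I_m}, 0 <= val_fun S;
  val_set0 : val_fun finset.set0 = 0;
  val_mono : forall S T : {set 'I_m}, S \subset T -> val_fun S <= val_fun T }.

Definition additive_fun (R : realType) (m : nat) (a : 'I_m -> R)
  (B : {set 'I_m}) : R := \sum_(j in B) a j.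

(* The collection (a_l) is nonempty and its members are nonnegative, so the
   neutral element 0 of the iterated maximum does not contribute to it. *)
Definition is_xos (R : realType) (m : nat) (v : valuation R m) : Prop :=
  exists (k : nat) (a : 'I_k.+1 -> 'I_m -> R),
    (forall l j, 0 <= a l j) /\
    (forall B : {set 'I_m},
       v B = \big[Num.max/0]_(l < k.+1) additive_fun (a l) B).

Definition is_submodular (R : realType) (m : nat) (v : valuation R m) : Prop :=
  forall (A B : {set 'I_m}) (j : 'I_m), A \subset B -> j \notin B ->
    v (j |: B) - v B <= v (j |: A) - v A.

Section submodular_xos.
Variables (R : realType) (m : nat) (v : valuation R m).
Hypothesis v_submodular : is_submodular v.

Let below (C : {set 'I_m}) (k : nat) : {set 'I_m} :=
  [set i in C | (i < k)%N]%SET.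

(* Marginal values of the elements of C, added in increasing order. *)
Let marg (C : {set 'I_m}) (j : 'I_m) : R :=
  if j \in C then v (below C j.+1) - v (below C j) else 0.

Let belowS (C : {set 'I_m}) (j : 'I_m) :
  below C j.+1 = if j \in C then j |: below C j else below C j.
Proof.
apply/setP => i; have [->|ij] := eqVneq i j.
  by case: ifPn => jC; rewrite !inE ltnSn ?eqxx ?jC ?(negPf jC).
have ltE : (i < j.+1)%N = (i < j)%N.
  by rewrite ltnS [RHS]ltn_neqAle (inj_eq val_inj) ij.
by case: ifPn => jC; rewrite !inE ltE // (negPf ij).
Qed.

Let marg_sum (C B : {set 'I_m}) (k : nat) : (k <= m)%N ->
  \sum_(j in B | (j < k)%N) marg C j <= v (below (B :&: C)%SET k) /\
  (B = C -> \sum_(j in B | (j < k)%N) marg C j = v (below (B :&: C)%SET k)).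
Proof.
elim: k => [_|k IH km].
  have -> : below (B :&: C)%SET 0 = finset.set0.
    by apply/setP => i; rewrite !inE ltn0 andbF.
  by rewrite big_pred0 ?val_set0// => i; rewrite ltn0 andbF.
have [IHle IHeq] := IH (ltnW km).
pose j := Ordinal km.
have splitS : \sum_(i in B | (i < k.+1)%N) marg C i =
    (if j \in B then marg C j else 0) + \sum_(i in B | (i < k)%N) marg C i.
  case: ifPn => jB.
    rewrite (bigD1 j) ?jB ?ltnSn //=; congr +%R.
    apply: eq_bigl => i; rewrite -andbA; congr (_ && _).
    by rewrite -(inj_eq val_inj)/= ltnS ltn_neqAle andbC.
  rewrite add0r; apply: eq_bigl => i; rewrite ltnS leq_eqVlt.
  have [ik|//] := eqVneq (i : nat) k.
  by rewrite (_ : i = j) ?(negPf jB)//; exact: val_inj.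
have belS := belowS _ j; rewrite /= in belS.
rewrite splitS belS inE.
case: (boolP (j \in B)) => jB /=; last by rewrite add0r.
rewrite /marg/= belS.
case: (boolP (j \in C)) => jC /=; last by rewrite add0r.
split=> [|BC]; last first.
  by rewrite (IHeq BC) BC finset.setIid subrK.
rewrite -lerBrDr; apply: le_trans (_ : _ <= v (j |: below (B :&: C)%SET k) -
  v (below (B :&: C)%SET k)) _; last exact: lerB.
apply: v_submodular; last by rewrite !inE ltnn andbF.
by apply/fintype.subsetP => i; rewrite !inE => /andP[/andP[_ ->] ->].
Qed.

Lemma submodular_xos : is_xos v.
Proof.
have belm C : below C m = C by apply/setP => i; rewrite !inE ltn_ord andbT.
have sumE C (B : {set 'I_m}) : \sum_(j in B | (j < m)%N) marg C j = additive_fun (marg C) B.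
  by rewrite /additive_fun; apply: eq_bigl => j; rewrite ltn_ord andbT.
exists #|{set 'I_m}|, (fun l => marg (nth finset.set0 (enum {set 'I_m}) l)).
split=> [l j|B].
  rewrite /marg; case: ifP => // _; rewrite subr_ge0; apply: val_mono.
  by apply/fintype.subsetP => i; rewrite !inE => /andP[-> /ltnW].
apply/eqP; rewrite eq_le; apply/andP; split; last first.
  apply: bigmax_le => [|l _]; first exact: val_ge0.
  have [+ _] := marg_sum (nth finset.set0 (enum {set 'I_m}) l) B (leqnn m).
  rewrite belm sumE => /le_trans; apply; apply: val_mono.
  exact: finset.subsetIl.
have BS : (index B (enum {set 'I_m}) < #|{set 'I_m}|.+1)%N.
  by rewrite ltnS cardE index_size.
have [_ /(_ erefl)] := marg_sum B B (leqnn m).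
rewrite belm sumE finset.setIid => vB.
have nthB : nth finset.set0 (enum {set 'I_m}) (Ordinal BS) = B.
  by rewrite nth_index ?mem_enum.
rewrite -[leLHS]vB -{1}nthB.
exact: (le_bigmax _ (fun l : 'I_#|{set 'I_m}|.+1 =>
  additive_fun (marg (nth finset.set0 (enum {set 'I_m}) l)) B)).
Qed.

End submodular_xos.

Record xos_valuation (R : realType) (m : nat) := XOSValuation {
  xos_val :> valuation R m;
  xos_valP : is_xos xos_val }.

(* Measurable structure of xos_valuation: the sigma-algebra generated by the
   evaluations v |-> v B, i.e. the trace of the Borel sets of R^(2^m). *)
Section xos_valuation_measurable.
Variables (R : realType) (m : nat).

Let zero_ge0 (S : {set 'I_m}) : 0 <= (fun=> 0 : R) S.
Proof. by []. Qed.

Let zero_mono (S T : {set 'I_m}) : S \subset T ->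
  (fun=> 0 : R) S <= (fun=> 0 : R) T.
Proof. by []. Qed.

Definition zero_valuation : valuation R m :=
  Valuation zero_ge0 erefl zero_mono.

Lemma zero_valuation_xos : is_xos zero_valuation.
Proof.
by apply: submodular_xos => A B j _ _ /=.
Qed.

HB.instance Definition _ := gen_eqMixin (xos_valuation R m).
HB.instance Definition _ := gen_choiceMixin (xos_valuation R m).
HB.instance Definition _ := isPointed.Build (xos_valuation R m)
  (XOSValuation zero_valuation_xos).

Definition xos_eval (B : {set 'I_m}) (v : xos_valuation R m) : R := v B.

Definition xos_measurable : set (set (xos_valuation R m)) :=
  <<s \bigcup_(B in [set: {set 'I_m}])
        preimage_set_system setT (xos_eval B) measurable >>.

Let xos_measurable0 : xos_measurable set0.
Proof. exact: sigma_algebra0. Qed.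

Let xos_measurableC (U : set (xos_valuation R m)) :
  xos_measurable U -> xos_measurable (~` U).
Proof. exact: sigma_algebraC. Qed.

Let xos_measurableU (F : (set (xos_valuation R m))^nat) :
  (forall i, xos_measurable (F i)) -> xos_measurable (\bigcup_i F i).
Proof. exact: sigma_algebra_bigcup. Qed.

HB.instance Definition _ :=
  @isMeasurable.Build default_measure_display (xos_valuation R m)
    xos_measurable xos_measurable0 xos_measurableC xos_measurableU.

End xos_valuation_measurable.

(* One valuation per buyer, with the product sigma-algebra. *)
Notation profile R n m := (n.-tuple (xos_valuation R m)).

Definition is_product_distribution (R : realType) (n m : nat)
    (D_ : 'I_n -> probability (xos_valuation R m) R)
    (D : probability (profile R n m) R) : Prop :=
  forall A : 'I_n -> set (xos_valuation R m), (forall i, measurable (A i)) ->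
    D [set v : profile R n m | forall i, A i (tnth v i)] =
    (\prod_(i < n) D_ i (A i))%E.

(* alg_alloc r s v i is the bundle given to buyer i when the internal
   randomness is r, the sample profile is s and the actual profile is v.
   alg_disjoint says that only items which are still unallocated are handed
   out, alg_online that the decision for buyer i does not depend on the
   valuations of the buyers arriving after i. *)
Record online_algorithm (R : realType) (n m : nat) := OnlineAlgorithm {
  alg_display : measure_display;
  alg_seed : measurableType alg_display;
  alg_law : probability alg_seed R;
  alg_alloc : alg_seed -> profile R n m -> profile R n m ->
    'I_n -> {set 'I_m};
  alg_disjoint : forall r s v (i j : 'I_n), i != j ->
    [disjoint alg_alloc r s v i & alg_alloc r s v j]%B;
  alg_online : forall r s (v v' : profile R n m) (i : 'I_n),
    (forall j : 'I_n, (j <= i)%N -> tnth v j = tnth v' j) ->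
    alg_alloc r s v i = alg_alloc r s v' i;
  alg_measurable : forall (i : 'I_n) (A : {set 'I_m}),
    measurable [set x : alg_seed * profile R n m * profile R n m |
                 alg_alloc x.1.1 x.1.2 x.2 i = A] }.
Arguments alg_alloc {R n m} o r s v i.

Definition welfare (R : realType) (n m : nat) (v : profile R n m)
  (A : 'I_n -> {set 'I_m}) : R := \sum_(i < n) tnth v i (A i).

Definition is_allocation (n m : nat) (A : {ffun 'I_n -> {set 'I_m}}) : bool :=
  [forall i, forall j, (i != j) ==> [disjoint A i & A j]%B].

(* The empty allocation is admissible and welfare is nonnegative, so the
   neutral element 0 does not contribute to the maximum. *)
Definition optimal_welfare (R : realType) (n m : nat) (v : profile R n m) : R :=
  \big[Num.max/0]_(A : {ffun 'I_n -> {set 'I_m}} | is_allocation A)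
    welfare v A.

(* The seed r, the samples s ~ D and the valuations v ~ D are independent. *)
Definition expected_alg_welfare (R : realType) (n m : nat)
    (ALG : online_algorithm R n m) (D : probability (profile R n m) R) : \bar R :=
  ('E_((alg_law ALG \x D) \x D)
     [fun x => welfare x.2 (alg_alloc ALG x.1.1 x.1.2 x.2)])%E.

Definition expected_optimal_welfare (R : realType) (n m : nat)
    (D : probability (profile R n m) R) : \bar R :=
  ('E_D[fun v => optimal_welfare v])%E.

(* Main.v *)
Require Import Defs.
From HB Require Import structures.
From mathcomp Require Import all_boot all_order all_algebra.
From mathcomp Require Import lra.
From mathcomp Require Import all_classical all_reals all_analysis.
From mathcomp Require Import measurable_realfun.

(* Every buyer gets one of three roles at random: price setter (in A), threshold
   setter (in B but not in A) or customer (in neither). Setters act with their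
   sample, customers with their actual valuation, so for fixed roles the
   valuations in use are distributed according to D. Hence it suffices to
   compare the welfare averaged over the roles with the optimum for one fixed
   profile.

   Items start at price 0. Buyer i bids an additive minorant q of its valuation,
   with q j = 0 or q j at least twice the current price of j, of nearly maximal
   total. The bids of a price setter become the new prices. Either bids are
   large or prices are, so OPT <= 4 * (all bids + final prices). The bids of the
   price setters double, hence sum up to at most twice the final prices, and
   since the role of i is independent of its bid this also bounds the sum of all
   bids on average.

   For the same reason the best bid on an item from outside A is on average at
   least half of its final price: a new overall maximum is as likely to come
   from outside A as from A. Given A, the bids from outside A are fixed numbers,
   and an item goes to the first customer outbidding all threshold setters. This
   is the highest bidder outside A with probability at least 1/4, namely if it
   is a customer while the second highest bidder is a threshold setter. *)

Set Implicit Arguments.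
Unset Strict Implicit.
Unset Printing Implicit Defensive.
Import Order.TTheory GRing.Theory Num.Theory.
Local Open Scope ring_scope.

(** * Averaging over random sets by switching the role of one element *)

Definition toggle (T : finType) (i : T) (A : {set T}) : {set T} :=
  [set k | (k \in A) (+) (k == i)].

Section toggle.
Variables (T : finType) (i : T).

Lemma toggleK : involutive (toggle i).
Proof. by move=> A; apply/setP => k; rewrite !inE addbK. Qed.

Lemma in_toggle A : (i \in toggle i A) = (i \notin A).
Proof. by rewrite inE eqxx addbT. Qed.

Lemma in_toggle_neq A k : k != i -> (k \in toggle i A) = (k \in A).
Proof. by move=> /negPf ki; rewrite inE ki addbF. Qed.

Lemma sum_toggle (V : nmodType) (f : {set T} -> V) :
  \sum_A f (toggle i A) = \sum_A f A.
Proof.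
by rewrite [RHS](reindex (toggle i)) //; apply/onW_bij/inv_bij/toggleK.
Qed.

(** Since [toggle i] permutes the sets, summing the hypothesis counts every set twice on both sides.
    This is the averaging over the role of [i] with all other roles fixed. *)
Lemma ler_sum_toggle (f g : {set T} -> rat) :
  (forall A, f A + f (toggle i A) <= g A + g (toggle i A)) ->
  \sum_A f A <= \sum_A g A.
Proof.
move=> fg; have := ler_sum _ (fun A _ => fg A : _ <= _).
by move=> /(_ (index_enum _) xpredT); rewrite !big_split/= !sum_toggle; lra.
Qed.

End toggle.

(** * Prices and bids in one pass over the buyers *)

Lemma ltn_ordS n (i k : 'I_n) : i != k -> (i < k.+1)%N = (i < k)%N.
Proof.
by rewrite ltnS [RHS]ltn_neqAle => ik; rewrite (inj_eq val_inj) ik.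
Qed.

Notation price m := {ffun 'I_m -> rat}.

Section run.
Variables (n m : nat) (respond : 'I_n -> price m -> price m).

Definition step (A : {set 'I_n}) (p : price m) (i : 'I_n) : price m :=
  if i \in A then [ffun j => Num.max (p j) (respond i p j)] else p.

Definition prices (A : {set 'I_n}) (k : nat) : price m :=
  foldl (step A) [ffun=> 0] (take k (enum 'I_n)).

(** Buyers outside [A] have a bid too: their answer to the prices they face, which leaves the prices
    unchanged. *)
Definition bid (A : {set 'I_n}) (i : 'I_n) : price m := respond i (prices A i).

Lemma prices0 A : prices A 0 = [ffun=> 0].
Proof. by rewrite /prices take0. Qed.

Lemma pricesS A (i : 'I_n) : prices A i.+1 = step A (prices A i) i.
Proof.
rewrite /prices (take_nth i) ?size_enum_ord ?ltn_ord// nth_ord_enum.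
by rewrite -cats1 foldl_cat.
Qed.

Lemma pricesSE A (i : 'I_n) j : prices A i.+1 j =
  if i \in A then Num.max (prices A i j) (bid A i j) else prices A i j.
Proof. by rewrite pricesS /step; case: ifP => // _; rewrite ffunE. Qed.

Lemma eq_prices (A B : {set 'I_n}) k :
  (forall i : 'I_n, (i < k)%N -> (i \in A) = (i \in B)) ->
  prices A k = prices B k.
Proof.
move=> AB; rewrite /prices.
have : {subset take k (enum 'I_n) <= [pred i : 'I_n | (i < k)%N]}.
  move=> i /(map_f val).
  rewrite map_take val_enum_ord take_iota mem_iota/= add0n inE leq_min.
  by case/andP.
elim: (take _ _) [ffun=> 0] => //= i s IH p sub.
rewrite IH => [|x xs]; last by apply: sub; rewrite inE xs orbT.
by congr foldl; rewrite /step AB//; apply: sub; rewrite mem_head.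
Qed.

Lemma prices_toggle A (i : 'I_n) k : (k <= i)%N ->
  prices (toggle i A) k = prices A k.
Proof.
move=> ki; apply: eq_prices => l lk; rewrite in_toggle_neq//.
by apply: contraTneq lk => ->; rewrite -leqNgt.
Qed.

(** Prices before [i] come from earlier buyers only, so the bid of [i] is independent of its own
    role. Both comparisons averaged over [A] rest on this. *)
Lemma bid_toggle A i : bid (toggle i A) i = bid A i.
Proof. by rewrite /bid prices_toggle. Qed.

Hypothesis respond_ge0 : forall i p (j : 'I_m), 0 <= respond i p j.
Hypothesis respond_double : forall i p (j : 'I_m),
  respond i p j = 0 \/ 2 * p j <= respond i p j.

Lemma prices_ge0 A k j : 0 <= prices A k j.
Proof.
elim: k => [|k IH]; first by rewrite prices0 ffunE.
have [kn|nk] := ltnP k n; last first.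
  by move: IH; rewrite /prices !take_oversize// ?size_enum_ord// ltnW.
by rewrite (pricesSE A (Ordinal kn)) fun_if le_max IH if_same.
Qed.

Lemma prices_le A k l j : (k <= l <= n)%N -> prices A k j <= prices A l j.
Proof.
case/andP=> kl; rewrite -(subnKC kl).
elim: (l - k)%N => [|d IH]; rewrite ?addn0//.
rewrite addnS => ln; apply: le_trans (IH (ltnW ln)) _.
by rewrite (pricesSE A (Ordinal ln)); case: ifP => // _; rewrite le_max lexx.
Qed.

(* The bids accepted in A at least double, so their sum telescopes. *)
Lemma sum_bid_le (A : {set 'I_n}) j :
  \sum_(i in A) bid A i j <= 2 * prices A n j.
Proof.
suff H k : (k <= n)%N ->
    \sum_(i in A | (i < k)%N) bid A i j <= 2 * prices A k j.
  apply: le_trans (H n (leqnn n)); rewrite le_eqVlt; apply/orP; left; apply/eqP.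
  by apply: eq_bigl => i; rewrite ltn_ord andbT.
elim: k => [_|k IH kn].
  by rewrite big_pred0 ?mulr_ge0 ?prices_ge0// => i; rewrite ltn0 andbF.
have {}IH := IH (ltnW kn); pose i0 := Ordinal kn.
have ltE (i : 'I_n) : i != i0 -> (i < k.+1)%N = (i < k)%N := @ltn_ordS n i i0.
rewrite (pricesSE A i0); case: ifPn => iA.
  rewrite (bigD1 i0) ?iA ?ltnSn//=.
  have -> : \sum_(i | (i \in A) && (i < k.+1)%N && (i != i0)) bid A i j =
            \sum_(i in A | (i < k)%N) bid A i j.
    apply: eq_bigl => i; case: (eqVneq i i0) => [->|/ltE->]; rewrite ?andbT//=.
    by rewrite ltnn !andbF.
  have p0 := prices_ge0 A k j; have b0 : 0 <= bid A i0 j := respond_ge0 _ _ _.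
  have [b|b] : bid A i0 j = 0 \/ 2 * prices A k j <= bid A i0 j.
    exact: respond_double.
    by rewrite b add0r (max_idPl p0).
  (* A bid [b] of at least twice the price [p] satisfies [b + 2p <= 2b], so the new price pays for
     this bid and for all earlier ones. *)
  have : bid A i0 j <= Num.max (prices A k j) (bid A i0 j).
    by rewrite le_max lexx orbT.
  by move: IH b; set S := \sum_(i in A | _) _; lra.
apply: le_trans IH; rewrite le_eqVlt; apply/orP; left; apply/eqP.
apply: eq_bigl => i; case: (eqVneq i i0) => [->|/ltE->//].
by rewrite (negPf iA).
Qed.

Definition outside_max (A : {set 'I_n}) (k : nat) (j : 'I_m) : rat :=
  \big[Num.max/0]_(i : 'I_n | (i < k)%N && (i \notin A)) bid A i j.

Lemma outside_maxS (A : {set 'I_n}) (i : 'I_n) j : outside_max A i.+1 j =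
  if i \in A then outside_max A i j
  else Num.max (outside_max A i j) (bid A i j).
Proof.
have ltE k := @ltn_ordS n k i.
rewrite /outside_max; case: ifPn => iA.
  apply: eq_bigl => k; case: (eqVneq k i) => [->|/ltE->//].
  by rewrite iA !andbF.
rewrite (bigD1 i) ?iA ?ltnSn//= maxC; congr Num.max.
apply: eq_bigl => k; case: (eqVneq k i) => [->|/ltE->]; rewrite ?andbT//=.
by rewrite ltnn !andbF.
Qed.

Lemma outside_max_toggle A (i : 'I_n) j :
  outside_max (toggle i A) i j = outside_max A i j.
Proof.
have ne (k : 'I_n) : (k < i)%N -> k != i.
  by move=> ki; apply: contraTneq ki => ->; rewrite ltnn.
apply: eq_big => [k|k /andP[ki _]].
  by case: ltnP => //= ki; rewrite in_toggle_neq// ne.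
by rewrite /bid prices_toggle// ltnW.
Qed.

(* Given the history before i, a bid of i counts for the best outside bid or for
   the price with equal probability. *)
Lemma sum_prices_le_outside_max j :
  \sum_A prices A n j <= \sum_A 2 * outside_max A n j.
Proof.
(* The induction needs the overall maximum on the left: the average of [2 * outside_max] minus this
   maximum never decreases with [k]. *)
suff H k : (k <= n)%N ->
    \sum_A Num.max (outside_max A k j) (prices A k j) <=
    \sum_A 2 * outside_max A k j.
  apply: le_trans (H n (leqnn n)); apply: ler_sum => A _.
  by rewrite le_max lexx orbT.
elim: k => [_|k IH kn].
  apply: ler_sum => A _; rewrite /outside_max prices0 ffunE big_pred0.
    by rewrite maxxx mulr0.
  by move=> i; rewrite ltn0.
have {}IH := IH (ltnW kn); pose i := Ordinal kn.
rewrite -subr_ge0 -sumrB; rewrite -subr_ge0 -sumrB in IH.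
apply: le_trans IH _; apply: (@ler_sum_toggle _ i) => A.
rewrite !(outside_maxS _ i) !(pricesSE _ i) in_toggle bid_toggle -[k]/(i : nat).
rewrite outside_max_toggle prices_toggle//.
(* Here [x] is the best outside bid, [y] the price and [z] the bid of [i]. In either role the
   overall maximum becomes that of all three; it grows by no more than [x] does when [i] is outside
   [A]. *)
have maxs (x y z : rat) :
    Num.max x (Num.max y z) - Num.max x y <= Num.max x z - x.
  have [xy xz] : x <= Num.max x y /\ x <= Num.max x z by rewrite !le_max !lexx.
  have : z <= Num.max x z by rewrite le_max lexx orbT.
  by rewrite maxA; case: (leP (Num.max x y) z); lra.
move: (maxs (outside_max A i j) (prices A i j) (bid A i j)).
have maxE : Num.max (Num.max (outside_max A i j) (bid A i j)) (prices A i j) =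
    Num.max (outside_max A i j) (Num.max (prices A i j) (bid A i j)).
  by rewrite -maxA [X in Num.max _ X]maxC.
by case: ifP => _ /=; rewrite maxE; lra.
Qed.

End run.

Lemma eq_prices_respond n m (r r' : 'I_n -> price m -> price m)
    (A : {set 'I_n}) k :
  (forall i, i \in A -> r i (prices r A i) = r' i (prices r A i)) ->
  prices r A k = prices r' A k.
Proof.
move=> rr'; elim: k => [|k IH]; first by rewrite !prices0.
have [kn|nk] := ltnP k n; last first.
  by move: IH; rewrite /prices !take_oversize// ?size_enum_ord// ltnW.
rewrite !(pricesS _ _ (Ordinal kn)) -IH /step; case: ifP => // kA.
by apply/ffunP => j; rewrite !ffunE (rr' _ kA).
Qed.

(** Replaying the fixed answers [q] yields the prices each buyer would face, so the event that the
    bids are [q] splits into one condition per buyer. Measurability uses this form. *)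
Lemma bid_history n m (r : 'I_n -> price m -> price m)
    (A : {set 'I_n}) (q : 'I_n -> price m) :
  (forall i, bid r A i = q i) <->
  (forall i, r i (prices (fun k _ => q k) A i) = q i).
Proof.
split=> rq i.
  rewrite -(@eq_prices_respond _ _ r) => [|k _]; [exact: rq|exact: rq].
rewrite /bid -(@eq_prices_respond _ _ (fun k _ => q k)) => [|k _].
  exact: rq.
by rewrite rq.
Qed.

(** * Selling a single item against thresholds *)

Section select.
Variables (n : nat) (b : 'I_n -> rat) (A : {set 'I_n}).

(* Ties between equal bids are broken by the index of the buyer. *)
Definition bid_key (i : 'I_n) : (rat *l 'I_n)%type := (b i, i).

Definition accepted (B : {set 'I_n}) (i : 'I_n) : bool :=
  [&& i \notin A, i \notin B, 0 < b i &
      [forall k, (k \notin A) && (k \in B) ==>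
                 (bid_key k < bid_key i)%O]].

Definition winner (B : {set 'I_n}) (i : 'I_n) : bool :=
  accepted B i && [forall k : 'I_n, (k < i)%N ==> ~~ accepted B k].

Lemma winner_uniq B i k : winner B i -> winner B k -> i = k.
Proof.
move=> /andP[ai /forallP fi] /andP[ak /forallP fk]; apply/val_inj/eqP.
have:= fi k; have := fk i; rewrite ai ak !implybF -!leqNgt => ki ik.
by rewrite eqn_leq ki ik.
Qed.

Hypothesis b_ge0 : forall i, 0 <= b i.

(* The best bidder i outside A wins if it is outside B and the second best
   one is in B. *)
Lemma sum_winner i0 : i0 \notin A ->
  \sum_(B : {set 'I_n}) b i0 <=
  \sum_(B : {set 'I_n}) 4 * \sum_(i | winner B i) b i.
Proof.
move=> i0A; pose C := [pred i | i \notin A].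
have [i iA imax] := @Order.TotalTheory.arg_maxP _ _ _ i0 C bid_key i0A.
have bi0 : b i0 <= b i.
  have : (((b i0, i0) : rat *l 'I_n) <= ((b i, i) : rat *l 'I_n))%O.
    exact: imax.
  by rewrite lexi_pair => /andP[].
apply: (@le_trans _ _ (\sum_(B : {set 'I_n}) b i)); first exact: ler_sum.
have gain_ge0 B : 0 <= \sum_(i | winner B i) b i by apply: sumr_ge0.
have [bi|] := ltP 0 (b i); last first.
  by move=> bi; apply: ler_sum => B _; apply: le_trans bi _; rewrite mulr_ge0.
have gain B : winner B i -> b i <= \sum_(i | winner B i) b i.
  by move=> w; rewrite (bigD1 i)//= lerDl sumr_ge0.
(* Exactly one of [B] and [toggle i B] omits [i], whence the factor 2. *)
apply: (@le_trans _ _ (\sum_(B : {set 'I_n}) 2 * ((i \notin B)%:R * b i))).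
  apply: (@ler_sum_toggle _ i) => B; rewrite in_toggle.
  by case: (i \in B) => /=; lra.
pose C' := [pred k | (k \notin A) && (k != i)].
(* Without a rival outside [A], buyer [i] wins whenever it is outside [B]. *)
case: (pickP C') => [l0 l0P|none]; last first.
  apply: ler_sum => B _; case: (boolP (i \in B)) => iB.
    by rewrite mul0r mulr0 mulr_ge0.
  suff /gain : winner B i by rewrite mul1r; have := b_ge0 i; lra.
  apply/andP; split.
    rewrite /accepted -[i \notin A]/(C i) iA iB bi/=.
    apply/forallP => k; apply/implyP.
    move=> /andP[kA kB]; have := none k; rewrite /= kA/= => /negbFE/eqP ki.
    by rewrite -ki kB in iB.
  apply/forallP => k; apply/implyP => ki; apply/negP => /and3P[kA _ _].
  by have := none k; rewrite /= kA/= => /negbFE/eqP ki'; rewrite ki' ltnn in ki.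
have [l /andP[lA li] lmax] :=
  @Order.TotalTheory.arg_maxP _ _ _ l0 C' bid_key l0P.
(* Exactly one of [B] and [toggle l B] contains the runner-up [l], which doubles the factor. *)
apply: (@le_trans _ _ (\sum_(B : {set 'I_n})
    4 * ((i \notin B) && (l \in B))%:R * b i)).
  apply: (@ler_sum_toggle _ l) => B; rewrite in_toggle in_toggle_neq 1?eq_sym//.
  by case: (i \in B) => /=; case: (l \in B) => /=; have := b_ge0 i; lra.
apply: ler_sum => B _; case: andP => [[iB lB]|_]; last first.
  by rewrite mulr0 mul0r mulr_ge0.
rewrite mulr1 ler_pM2l//; apply: gain.
apply/andP; split.
  rewrite /accepted -[i \notin A]/(C i) iA iB bi/=.
  apply/forallP => k; apply/implyP.
  move=> /andP[kA kB]; rewrite lt_neqAle; apply/andP; split; last exact: imax.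
  by apply: contraNneq iB => -[_ <-].
(* An earlier accepted buyer would have to beat [l], but outside [A] only [i] does. *)
apply/forallP => k; apply/implyP => ki.
apply/negP => /and4P[kA kB _ /forallP/(_ l)].
rewrite lA lB/= ltNge => /negP; apply.
apply: lmax; rewrite /= kA/=.
by apply: contraTneq ki => ->; rewrite ltnn.
Qed.

End select.

(** Acceptance compares a bid with those in [B] only, and winning looks back at earlier buyers only;
    hence the rule can be applied online. *)
Lemma eq_winner n (b b' : 'I_n -> rat) (A B : {set 'I_n}) (i : 'I_n) :
  (forall k : 'I_n, (k \in B) || (k <= i)%N -> b k = b' k) ->
  winner b A B i = winner b' A B i.
Proof.
move=> bb'.
have acc (k : 'I_n) : (k <= i)%N -> accepted b A B k = accepted b' A B k.
  move=> ki; rewrite /accepted (bb' k) ?ki ?orbT//; congr [&& _, _, _ & _].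
  apply: eq_forallb => l; case: (boolP (l \in B)) => lB; rewrite ?andbF// andbT.
  by rewrite /bid_key (bb' k) ?ki ?orbT// (bb' l) ?lB.
rewrite /winner acc//; congr (_ && _); apply: eq_forallb => k.
by case: ltnP => //= ki; rewrite acc// ltnW.
Qed.

(** * Rational bids of nearly maximal total *)

Section demand.
Variables (R : realType) (m : nat).
Implicit Types (v : valuation R m) (p q : price m).

Definition admissible v p q : bool :=
  [forall j, (0 <= q j) && ((q j == 0) || (2 * p j <= q j))] &&
  [forall S : {set 'I_m}, \sum_(j in S) ratr (q j) <= v S].

(** The factor 2 leaves room for a supremum that no rational bid attains. *)
Definition demand v p q : Prop :=
  admissible v p q /\
  forall q', admissible v p q' -> \sum_j q' j <= 2 * \sum_j q j.

Lemma demand_exists v p : exists q, demand v p q.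
Proof.
have adm0 : admissible v p [ffun=> 0].
  apply/andP; split; apply/forallP => x; first by rewrite ffunE lexx eqxx.
  by rewrite big1 ?val_ge0// => j _; rewrite ffunE rmorph0.
pose E : set R := [set ratr (\sum_j q j) |
    q in [set q : price m | admissible v p q]]%classic.
have E_ub : has_ubound E.
  exists (v finset.setT) => _ [q /andP[_ /forallP/(_ finset.setT)] + <-].
  by rewrite rmorph_sum/=; under eq_bigl do rewrite inE.
have E0 : E 0.
  exists [ffun=> 0] => //; rewrite big1 ?rmorph0// => j _.
  by rewrite ffunE.
have supE : has_sup E by split=> //; exists 0.
have supP q : admissible v p q -> ratr (\sum_j q j) <= sup E.
  by move=> qa; apply: ub_le_sup => //; exists q.
(* Half the supremum lies strictly below it only if it is positive; otherwise the zero bid is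
   optimal. *)
have [s0|s0] := leP (sup E) 0.
  exists [ffun=> 0]; split=> // q qa.
  rewrite [X in _ <= _ * X]big1 ?mulr0; last by move=> j _; rewrite ffunE.
  by rewrite -(ler_rat R) rmorph0; apply: le_trans (supP q qa) s0.
have [] := @sup_adherent _ E (sup E / 2) _ supE; first by rewrite divr_gt0.
move=> _ [q qa <-] sq; exists q; split=> // q' q'a.
rewrite -(ler_rat R) rmorphM/= ratr_nat.
by have := supP _ q'a; move: sq; lra.
Qed.

Lemma first_demand_exists v p :
  exists q, demand v p q /\
    forall q', demand v p q' -> (pickle q <= pickle q')%N.
Proof.
have ex : exists k, `[< exists q, pickle q = k /\ demand v p q >].
  have [q qd] := demand_exists v p.
  by exists (pickle q); apply/asboolP; exists q.
case: (ex_minnP ex) => k /asboolP[q [<- qd]] kmin; exists q; split=> // q' q'd.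
by apply: kmin; apply/asboolP; exists q'.
Qed.

(* Rational bids make the history of a run countable, so that measurability
   in the valuations only involves countably many comparisons. *)
Definition first_demand v p : price m := sval (cid (first_demand_exists v p)).

Lemma first_demandP v p : demand v p (first_demand v p).
Proof. by rewrite /first_demand; case: cid => q []. Qed.

(** Choosing the least code makes the choice unique and describes it by countably many [demand]
    conditions. *)
Lemma first_demandE v p q : first_demand v p = q <->
  demand v p q /\ forall q', (pickle q' < pickle q)%N -> ~ demand v p q'.
Proof.
rewrite /first_demand; case: cid => q0 [q0d q0min] /=; split=> [<-|[qd qmin]].
  by split=> // q' q'q /q0min; rewrite leqNgt q'q.
apply: (pcan_inj pickleK); apply/eqP; rewrite eqn_leq q0min//= leqNgt.
by apply/negP => /qmin.
Qed.

Lemma first_demand_ge0 v p j : 0 <= first_demand v p j.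
Proof. by have [/andP[/forallP/(_ j)/andP[]]] := first_demandP v p. Qed.

Lemma first_demand_double v p j :
  first_demand v p j = 0 \/ 2 * p j <= first_demand v p j.
Proof.
have [/andP[/forallP/(_ j)/andP[_ /orP[/eqP ?|?]] _] _] := first_demandP v p.
- by left.
- by right.
Qed.

Lemma first_demand_le v p (S : {set 'I_m}) :
  ratr (\sum_(j in S) first_demand v p j) <= v S.
Proof.
by have [/andP[_ /forallP/(_ S)]] := first_demandP v p; rewrite rmorph_sum.
Qed.

Lemma rat_half (x : R) : 0 <= x ->
  exists c : rat, 0 <= c /\ x / 2 <= ratr c <= x.
Proof.
rewrite le_eqVlt => /predU1P[<-|x0].
  by exists 0; rewrite mul0r rmorph0 !lexx.
have /rat_in_itvoo[c] : x / 2 < x by lra.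
rewrite in_itv/= => /andP[c1 c2]; exists c; split; last by rewrite !ltW.
by rewrite -(ler_rat R) rmorph0 ltW// (lt_trans _ c1)// divr_gt0.
Qed.

(** Round the weights of a supporting additive function down to rationals, losing at most a factor
    2. Items of [O] whose rounded weight is at least twice the price form an admissible bid; every
    other item of [O] weighs at most 4 times its price. *)
Lemma xos_le_first_demand v p (O : {set 'I_m}) :
  is_xos v -> (forall j, 0 <= p j) ->
  v O <= 4 * ratr (\sum_j first_demand v p j + \sum_(j in O) p j).
Proof.
move=> [k [a [a0 va]]] p0; rewrite va; apply: bigmax_le => [|l _].
  rewrite mulr_ge0// ler0q addr_ge0// sumr_ge0// => j _.
  exact: first_demand_ge0.
have [c cP] := choice (fun j => rat_half (a0 l j)).
pose q : price m :=
  [ffun j => if (j \in O) && (2 * p j <= c j) then c j else 0].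
have qa : admissible v p q.
  apply/andP; split; [apply/forallP => j|apply/forallP => S].
    rewrite ffunE; case: ifP => [/andP[_ ->]|_]; last by rewrite lexx eqxx.
    by rewrite orbT andbT; have [] := cP j.
  apply: (@le_trans _ _ (additive_fun (a l) S)); last first.
    by rewrite va; exact: (le_bigmax _ (fun l => additive_fun (a l) S)).
  apply: ler_sum => j _; rewrite ffunE; case: ifP => _; last by rewrite rmorph0.
  by have [_ /andP[]] := cP j.
have [_ /(_ q qa)] := first_demandP v p.
rewrite -(ler_rat R) rmorphM/= ratr_nat => qle.
suff : additive_fun (a l) O <=
    2 * ratr (\sum_j q j) + 4 * ratr (\sum_(j in O) p j).
  by rewrite rmorphD/=; lra.
have -> : \sum_j q j = \sum_(j in O) q j.
  rewrite [RHS]big_mkcond; apply: eq_bigr => j _.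
  by rewrite ffunE; case: (j \in O).
rewrite !rmorph_sum/= !mulr_sumr -big_split/=; apply: ler_sum => j jO.
have [c0 /andP[c1 c2]] := cP j.
have := p0 j; rewrite -(ler_rat R) rmorph0 => pj.
rewrite ffunE jO/=; case: ifPn => [_|]; first lra.
rewrite -ltNge -(ltr_rat R) rmorphM/= ratr_nat rmorph0. lra.
Qed.

End demand.

(** * Comparison with the optimum for one fixed profile *)

Section fixed_profile.
Variables (R : realType) (n m : nat) (w : profile R n m).

Let respond (i : 'I_n) : price m -> price m := first_demand (tnth w i).

Definition profile_bid (A : {set 'I_n}) (i : 'I_n) : price m :=
  bid (fun i => first_demand (tnth w i)) A i.

Definition bundle (A B : {set 'I_n}) (i : 'I_n) : {set 'I_m} :=
  [set j | winner (fun k => profile_bid A k j) A B i].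

Let P A j := prices respond A n j.
Let b A i j : rat := profile_bid A i j.

Let b_ge0 A i j : 0 <= b A i j. Proof. exact: first_demand_ge0. Qed.

Let P_ge0 A j : 0 <= P A j.
Proof. exact: prices_ge0. Qed.

Lemma welfare_bundle_ge A B :
  ratr (\sum_j \sum_(i | winner (fun k => b A k j) A B i) b A i j)
    <= welfare w (bundle A B).
Proof.
rewrite (exchange_big_dep xpredT)//= rmorph_sum; apply: ler_sum => i _.
apply: le_trans (first_demand_le _ (prices respond A i) (bundle A B i)).
rewrite ler_rat le_eqVlt; apply/orP; left; apply/eqP/eq_bigl => j.
by rewrite inE.
Qed.

Let cost A : rat := \sum_i \sum_j b A i j + \sum_j P A j.

(** Each share of the optimum is charged to its owner's bids and to current prices. Prices only rise
    and the shares are disjoint, so every final price is charged at most once. *)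
Lemma optimal_welfare_le_cost A : optimal_welfare w <= 4 * ratr (cost A).
Proof.
apply: bigmax_le => [|O /forallP Oalloc].
  rewrite mulr_ge0// ler0q addr_ge0//; last exact: sumr_ge0.
  by apply: sumr_ge0 => i _; apply: sumr_ge0.
have xosP i := xos_le_first_demand (O i) (xos_valP (tnth w i))
  (prices_ge0 respond A i).
apply: le_trans (ler_sum _ (fun i _ => xosP i)) _.
rewrite -mulr_sumr ler_pM2l// -rmorph_sum ler_rat big_split/= lerD2l.
apply: (@le_trans _ _ (\sum_i \sum_(j in O i) P A j)).
  apply: ler_sum => i _; apply: ler_sum => j _; apply: prices_le.
  by rewrite leqnn ltnW.
rewrite (exchange_big_dep xpredT)//=; apply: ler_sum => j _.
case: (pickP (fun i => j \in O i)) => [i ji|none]; last by rewrite big_pred0.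
rewrite (big_pred1 i)// => k; apply/idP/eqP => [jk|->//].
apply/eqP; apply: contraTT jk => ki.
have /forallP/(_ i)/implyP/(_ ki) := Oalloc k.
by move=> /disjointFl ->.
Qed.

(** On average all bids amount to twice those of the setters, hence to at most 4 times the final
    prices; the price term of [cost] adds 1. *)
Lemma sum_cost_le : \sum_A cost A <= \sum_A 5 * \sum_j P A j.
Proof.
suff : \sum_A \sum_i \sum_j b A i j <= \sum_A 4 * \sum_j P A j.
  by rewrite big_split/= -!mulr_sumr; lra.
apply: (@le_trans _ _ (\sum_(A : {set 'I_n})
    2 * \sum_j \sum_(i in A) b A i j)); last first.
  apply: ler_sum => A _; rewrite [4](_ : _ = 2 * 2)// -mulrA ler_pM2l//.
  rewrite mulr_sumr; apply: ler_sum => j _; apply: sum_bid_le => *.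
  - exact: first_demand_ge0.
  - exact: first_demand_double.
rewrite exchange_big/=.
have -> : \sum_(A : {set 'I_n}) 2 * (\sum_j \sum_(i in A) b A i j) =
    \sum_i \sum_(A : {set 'I_n}) 2 * ((i \in A)%:R * \sum_j b A i j).
  rewrite [RHS]exchange_big/=; apply: eq_bigr => A _.
  rewrite -mulr_sumr exchange_big/= big_mkcond/=; congr (_ * _).
  by apply: eq_bigr => i _; case: (i \in A); rewrite ?mul1r ?mul0r.
apply: ler_sum => i _; apply: (@ler_sum_toggle _ i) => A; rewrite in_toggle.
rewrite /b /profile_bid bid_toggle.
by case: (i \in A) => /=; lra.
Qed.

Let N : rat := #|{set 'I_n}|%:R.

Let gain A B j : rat := \sum_(i | winner (fun k => b A k j) A B i) b A i j.

(** A factor 2 leads from prices to the best outside bid and a factor 4 from there to the winning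
    bid. [N] counts the sets [B], on which prices do not depend. *)
Lemma sum_prices_le_winner j :
  N * \sum_A P A j <= 8 * \sum_A \sum_B gain A B j.
Proof.
have N_gt0 : 0 < N by rewrite ltr0n; apply/card_gt0P; exists finset.set0.
have PR : \sum_A P A j <= \sum_A 2 * outside_max respond A n j.
  exact: sum_prices_le_outside_max.
apply: (@le_trans _ _ (N * \sum_A 2 * outside_max respond A n j)).
  by rewrite ler_pM2l.
rewrite !mulr_sumr; apply: ler_sum => A _.
rewrite mulrCA [8](_ : _ = 2 * 4)// -mulrA ler_pM2l//.
rewrite mulrC -ler_pdivlMr//; apply: bigmax_le => [|i /andP[_ iA]].
  rewrite divr_ge0 ?mulr_ge0 ?(ltW N_gt0)// sumr_ge0// => B _.
  by apply: sumr_ge0 => *; exact: b_ge0.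
rewrite ler_pdivlMr// mulrC mulr_sumr.
have := sum_winner (fun k => b_ge0 A k j) iA.
by rewrite sumr_const -/N mulr_natl.
Qed.

(** The constant is [4 * 5 * 8], from [optimal_welfare_le_cost], [sum_cost_le] and
    [sum_prices_le_winner]. *)
Lemma optimal_welfare_le :
  (#|{set 'I_n}| * #|{set 'I_n}|)%:R * optimal_welfare w <=
  160 * \sum_(A : {set 'I_n}) \sum_(B : {set 'I_n}) welfare w (bundle A B).
Proof.
have : \sum_(A : {set 'I_n}) optimal_welfare w <= 4 * ratr (\sum_A cost A).
  rewrite rmorph_sum mulr_sumr; apply: ler_sum => A _.
  exact: optimal_welfare_le_cost.
rewrite sumr_const natrM -mulrA [_%:R * optimal_welfare w]mulr_natl => opt.
apply: (@le_trans _ _ (4 * (ratr N * ratr (\sum_A cost A)))).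
  rewrite mulrCA ratr_nat ler_pM2l// ltr0n.
  by apply/card_gt0P; exists finset.set0.
have N_ge0 : 0 <= N by rewrite ler0n.
have cost_le : N * \sum_A cost A <= 40 * \sum_A \sum_B \sum_j gain A B j.
  apply: (@le_trans _ _ (N * \sum_A 5 * \sum_j P A j)).
    by rewrite ler_wpM2l// sum_cost_le.
  rewrite -mulr_sumr mulrCA [40](_ : _ = 5 * 8)// -mulrA ler_pM2l//.
  rewrite exchange_big/= mulr_sumr.
  apply: le_trans (ler_sum _ (fun j _ => sum_prices_le_winner j)) _.
  rewrite -mulr_sumr ler_pM2l// le_eqVlt; apply/orP; left; apply/eqP.
  by rewrite exchange_big/=; apply: eq_bigr => A _; rewrite exchange_big.
rewrite -(ler_rat R) !rmorphM/= ratr_nat in cost_le.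
rewrite [160](_ : _ = 4 * 40)//; last by rewrite -natrM.
rewrite -mulrA ler_pM2l//; apply: le_trans cost_le _.
rewrite ler_pM2l// !rmorph_sum/=; apply: ler_sum => A _.
by rewrite rmorph_sum/=; apply: ler_sum => B _; exact: welfare_bundle_ge.
Qed.

End fixed_profile.

Lemma bundle_disjoint (R : realType) n m (w : profile R n m)
    (A B : {set 'I_n}) i k : i != k ->
  [disjoint bundle w A B i & bundle w A B k]%B.
Proof.
move=> ik; apply/pred0P => j /=; apply: contraNF ik.
rewrite !inE => /andP[wi wk].
by apply/eqP; apply: winner_uniq wi wk.
Qed.

(** Prices involve only [A], thresholds only [B]. As these buyers act with samples, known in
    advance, the allocation is online. *)
Lemma bundle_eq (R : realType) n m (w w' : profile R n m)
    (A B : {set 'I_n}) (i : 'I_n) :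
  (forall k : 'I_n, [|| k \in A, k \in B | (k <= i)%N] ->
    tnth w k = tnth w' k) ->
  bundle w A B i = bundle w' A B i.
Proof.
move=> ww'; apply/setP => j; rewrite [LHS]finset.in_set [RHS]finset.in_set.
apply: (@eq_winner _ (fun k => profile_bid w A k j)
                     (fun k => profile_bid w' A k j)) => k kB.
congr (fun_of_fin _ j); rewrite /profile_bid /bid ww'; last by rewrite kB orbT.
congr (first_demand _ _); apply: eq_prices_respond => l lA.
by rewrite ww' ?lA.
Qed.

Local Open Scope classical_set_scope.

(** * Measurability of bids and bundles *)

Lemma measurable_const_set d (T : measurableType d) (P : Prop) :
  measurable [set _ : T | P].
Proof.
have [p|np] := pselect P.
- by rewrite (_ : [set _ | _] = setT)//; apply/seteqP; split.
- by rewrite (_ : [set _ | _] = set0)//; apply/seteqP; split.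
Qed.

Lemma countable_bigcapT_measurable d (T : measurableType d) (I : countType)
    (F : I -> set T) :
  (forall i, measurable (F i)) -> measurable (\bigcap_i F i).
Proof.
move=> mF; rewrite -[X in measurable X]setCK; apply: measurableC.
rewrite setC_bigcap; apply: countable_bigcupT_measurable => [|i].
- exact: countableP.
- exact: measurableC.
Qed.

Lemma measurable_xos_eval (R : realType) m (S : {set 'I_m}) :
  measurable_fun setT (@xos_eval R m S).
Proof.
by move=> _ Y mY; apply: sub_sigma_algebra; exists S => //; exists Y.
Qed.

Section measurable_first_demand.
Variables (R : realType) (m : nat).
Implicit Types p q : price m.

Lemma measurable_admissible p q :
  measurable [set v : xos_valuation R m | admissible v p q].
Proof.
rewrite (_ : [set _ | _] = [set _ : xos_valuation R m |
    [forall j, (0 <= q j) && ((q j == 0) || (2 * p j <= q j))]] `&`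
  \bigcap_(S : {set 'I_m})
    xos_eval S @^-1` `[\sum_(j in S) ratr (q j), +oo[); last first.
  apply/seteqP; split=> v /=.
    move=> /andP[? /forallP vq]; split=> // S _ /=.
    by rewrite in_itv/= andbT; exact: vq.
  move=> [? vq]; apply/andP; split=> //; apply/forallP => S.
  by have := vq S I; rewrite /= in_itv/= andbT.
apply: measurableI; first exact: measurable_const_set.
apply: countable_bigcapT_measurable => S.
by rewrite -[X in measurable X]setTI; exact: measurable_xos_eval.
Qed.

Lemma measurable_demand p q :
  measurable [set v : xos_valuation R m | demand v p q].
Proof.
rewrite (_ : [set _ | _] = [set v : xos_valuation R m | admissible v p q] `&`
  \bigcap_(q' : price m) (~` [set v : xos_valuation R m | admissible v p q'] `|`
    [set _ | \sum_j q' j <= 2 * \sum_j q j])); last first.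
  apply/seteqP; split=> v /= [a H]; split=> // q'.
    move=> _; case: (boolP (admissible v p q')) => [/H|/negP]; first by right.
    by left.
  by move=> a'; case: (H q' I).
apply: measurableI; first exact: measurable_admissible.
apply: countable_bigcapT_measurable => q'; apply: measurableU.
- by apply: measurableC; exact: measurable_admissible.
- exact: measurable_const_set.
Qed.

Lemma measurable_first_demand p q :
  measurable [set v : xos_valuation R m | first_demand v p = q].
Proof.
rewrite (_ : [set _ | _] = [set v : xos_valuation R m | demand v p q] `&`
  \bigcap_(q' : price m) (~` [set v : xos_valuation R m | demand v p q'] `|`
    [set _ | ~~ (pickle q' < pickle q)%N])); last first.
  apply/seteqP; split=> v /=.
    move=> /first_demandE[a H]; split=> // q' _.
    by case: (boolP (pickle q' < pickle q)%N) => [/H|]; [left|right].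
  move=> [a H]; apply/first_demandE; split=> // q' q'q.
  by case: (H q' I) => // /negP.
apply: measurableI; first exact: measurable_demand.
apply: countable_bigcapT_measurable => q'; apply: measurableU.
- by apply: measurableC; exact: measurable_demand.
- exact: measurable_const_set.
Qed.

End measurable_first_demand.

(** There are countably many bid vectors [q], and by [bid_history] each of them imposes one
    measurable condition per buyer. *)
Lemma measurable_bundle (R : realType) n m (A B : {set 'I_n}) (i : 'I_n)
    (S : {set 'I_m}) :
  measurable [set w : profile R n m | bundle w A B i = S].
Proof.
pose won (q : {ffun 'I_n -> price m}) : {set 'I_m} :=
  [set j | winner (fun k => q k j) A B i]%SET.
rewrite (_ : [set _ | _] = \bigcup_(q : {ffun 'I_n -> price m})
    ([set w : profile R n m | forall k, profile_bid w A k = q k] `&`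
     [set _ | won q = S])); last first.
  apply/seteqP; split=> w /=.
    move=> wS; exists [ffun k => profile_bid w A k] => //=.
    split=> [k|]; first by rewrite ffunE.
    rewrite -wS; apply/setP => j; rewrite !inE.
    by apply: eq_winner => k _; rewrite ffunE.
  move=> [q _ /= [wq <-]]; apply/setP => j; rewrite !inE.
  by apply: eq_winner => k _; rewrite wq.
apply: countable_bigcupT_measurable => [|q]; first exact: countableP.
apply: measurableI; last exact: measurable_const_set.
rewrite (_ : [set _ | _] =
  \bigcap_(k in [set: 'I_n]) ((fun w : profile R n m => tnth w k) @^-1`
     [set v : xos_valuation R m |
        first_demand v (prices (fun k _ => q k) A k) = q k])); last first.
  apply/seteqP; split=> w /=; have [h1 h2] :=
    bid_history (fun k => first_demand (tnth w k)) A q.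
    by move=> wq k _; exact: h1.
  by move=> wq; apply: h2 => k; exact: (wq k I).
apply: fin_bigcap_measurable => [|k _]; first exact: finite_finset.
rewrite -[X in measurable X]setTI; apply: measurable_tnth => //.
exact: measurable_first_demand.
Qed.

(** * Replacing some actual valuations by samples *)

Section mix.
Variables (R : realType) (n m : nat).
Implicit Types (C : {set 'I_n}).

Definition mix C (s v : profile R n m) : profile R n m :=
  [tuple if i \in C then tnth s i else tnth v i | i < n].

Lemma tnth_mix C s v i :
  tnth (mix C s v) i = if i \in C then tnth s i else tnth v i.
Proof. by rewrite tnth_mktuple. Qed.

Lemma measurable_mix C : measurable_fun [set: profile R n m * profile R n m]
  (fun x => mix C x.1 x.2).
Proof.
apply/measurable_fun_tnthP => i.
apply: (eq_measurable_fun (fun x : profile R n m * profile R n m =>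
    if i \in C then tnth x.1 i else tnth x.2 i)).
  by move=> x _ /=; rewrite tnth_mix.
case: (i \in C).
- exact: (measurableT_comp (measurable_tnth i) (measurable_fst)).
- exact: (measurableT_comp (measurable_tnth i) (measurable_snd)).
Qed.

Let rect : set (set (profile R n m)) :=
  [set X | exists2 A : 'I_n -> set (xos_valuation R m),
     (forall i, measurable (A i)) & X = [set v | forall i, A i (tnth v i)]].

Let measurable_rect X : rect X -> measurable X.
Proof.
move=> [A mA ->].
rewrite (_ : [set _ | _] =
  \bigcap_(i in [set: 'I_n]) ((fun w : profile R n m => tnth w i) @^-1` A i)).
  apply: fin_bigcap_measurable => [|i _]; first exact: finite_finset.
  by rewrite -[X in measurable X]setTI; apply: measurable_tnth.
by apply/seteqP; split=> v /= H i; [move=> _|]; exact: H.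
Qed.

Let measurable_gen_rect : @measurable _ (profile R n m) = <<s rect >>.
Proof.
apply/seteqP; split; last first.
  apply: smallest_sub; last exact: measurable_rect.
  exact: sigma_algebra_measurable.
apply: smallest_sub; first exact: smallest_sigma_algebra.
rewrite -bigcup_seq => X [i _ [A mA <-]]; apply: sub_sigma_algebra.
exists (fun k => if k == i then A else setT) => [k|]; first by case: ifP.
apply/seteqP; split=> v /=; first by move=> [_ Av] k; case: eqP => [->|].
by move=> /(_ i); rewrite eqxx; split.
Qed.

Variables (D_ : 'I_n -> probability (xos_valuation R m) R)
  (D : probability (profile R n m) R).
Hypothesis D_product : is_product_distribution D_ D.


Definition mixp C (x : profile R n m * profile R n m) := mix C x.1 x.2.

HB.instance Definition _ C :=
  isMeasurableFun.Build _ _ _ _ (mixp C) (measurable_mix C).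

(** It suffices to compare on boxes, a generating family closed under intersection. The preimage of
    a box is a product of two boxes, constraining samples on [C] and valuations off [C]. *)
Lemma distribution_mix C X : measurable X ->
  distribution (D \x D)%E (mixp C) X = D X.
Proof.
move=> mX; apply: (measure_unique rect (fun=> setT) measurable_gen_rect _ _ _
  (distribution (D \x D)%E (mixp C)) D) => //.
- move=> _ _ [A mA ->] [A' mA' ->]; exists (fun i => A i `&` A' i).
    by move=> i; exact: measurableI.
  apply/seteqP; split=> v /= H; last by split=> i; case: (H i).
  by move=> i; case: H => H H'; split; [exact: H|exact: H'].
- by move=> _; exists (fun=> setT) => //; apply/seteqP; split.
- by apply/seteqP; split=> // x _; exists 0.
- move=> _ [A mA ->].
  pose A1 i := if i \in C then A i else setT.
  pose A2 i := if i \in C then setT else A i.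
  have mA1 i : measurable (A1 i) by rewrite /A1; case: ifP.
  have mA2 i : measurable (A2 i) by rewrite /A2; case: ifP.
  pose X1 : set (profile R n m) := [set s | forall i, A1 i (tnth s i)].
  pose X2 : set (profile R n m) := [set v | forall i, A2 i (tnth v i)].
  have mixE : mixp C @^-1` [set v | forall i, A i (tnth v i)] = X1 `*` X2.
    apply/seteqP; split=> -[s v]; rewrite /mixp /=.
      by move=> H; split=> i; have := H i; rewrite tnth_mix /A1 /A2; case: ifP.
    move=> [H1 H2] i; rewrite tnth_mix; have := H1 i; have := H2 i.
    by rewrite /A1 /A2; case: ifP.
  transitivity ((D \x D)%E (X1 `*` X2)); first by rewrite -mixE.
  rewrite product_measure1E; last 2 first.
  - by apply: measurable_rect; exists A1.
  - by apply: measurable_rect; exists A2.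
  apply: etrans (esym (D_product mA)).
  apply: etrans (congr2 _ (D_product mA1) (D_product mA2)) _.
  rewrite -big_split/=; apply: eq_bigr => i _; rewrite /A1 /A2.
  by case: ifP => _; rewrite probability_setT ?mule1 ?mul1e.
- by move=> _; apply: le_lt_trans (ltry 1); exact: probability_le1.
Qed.

End mix.

(** * A uniform random seed *)

Section uniform.
Variables (R : realType) (K : nat).

(** The atoms are [0, ..., K]; having [K.+1] of them gives total mass 1 for every [K]. *)
Definition uniform_nat : set nat -> \bar R :=
  mscale (K.+1%:R^-1)%:nng (msum (fun k => \d_k) K.+1).

HB.instance Definition _ := Measure.on uniform_nat.

Let uniform_nat_setT : uniform_nat setT = 1%E.
Proof.
rewrite /uniform_nat /mscale/= /msum/= (eq_bigr (fun=> 1%E)); last first.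
  by move=> k _; rewrite diracT.
rewrite sumEFin sumr_const card_ord -EFinM mulVf//.
Qed.

HB.instance Definition _ :=
  Measure_isProbability.Build _ _ _ uniform_nat uniform_nat_setT.

Lemma integral_uniform_nat (f : nat -> \bar R) : (forall k, 0 <= f k)%E ->
  (\int[uniform_nat]_x f x = K.+1%:R^-1%:E * \sum_(k < K.+1) f k)%E.
Proof.
move=> f0; rewrite ge0_integral_mscale//.
rewrite ge0_integral_measure_sum//; congr (_ * _)%E.
by apply: eq_bigr => k _; rewrite integral_dirac// diracT mul1e.
Qed.

End uniform.

(** * Measurability of welfare and optimum *)

Lemma measurable_welfare (R : realType) n m d (T : measurableType d)
  (X : T -> profile R n m) (Al : T -> 'I_n -> {set 'I_m}) :
  measurable_fun setT X ->
  (forall i S, measurable [set t | Al t i = S]) ->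
  measurable_fun setT (fun t => welfare (X t) (Al t)).
Proof.
move=> mX mA; apply: measurable_sum => i.
(* Splitting by the finitely many possible bundles leaves evaluations at a fixed bundle. *)
apply: (eq_measurable_fun (fun t => \sum_(S : {set 'I_m})
   \1_[set t | Al t i = S] t * xos_eval S (tnth (X t) i))).
  move=> t _; rewrite (bigD1 (Al t i))//= big1 ?addr0.
    by rewrite indicE mem_set// mul1r.
  by move=> S SA; rewrite indicE memNset ?mul0r//= => AS; rewrite AS eqxx in SA.
apply: measurable_sum => S; apply: measurable_funM.
  exact: measurable_indic.
apply: (measurableT_comp (measurable_xos_eval S)).
exact: (measurableT_comp (measurable_tnth i)).
Qed.

Lemma welfare_ge0 (R : realType) n m (v : profile R n m) A : 0 <= welfare v A.
Proof. by apply: sumr_ge0 => i _; exact: val_ge0. Qed.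

Lemma optimal_welfare_ge0 (R : realType) n m (v : profile R n m) :
  0 <= optimal_welfare v.
Proof. exact: bigmax_ge_id. Qed.

Lemma measurable_optimal_welfare (R : realType) n m :
  measurable_fun setT (@optimal_welfare R n m).
Proof.
rewrite /optimal_welfare.
have H (s : seq {ffun 'I_n -> {set 'I_m}}) : measurable_fun setT
  (fun v : profile R n m =>
     \big[Num.max/0]_(A <- s | is_allocation A) welfare v A).
  elim: s => [|A s IH].
    apply: (eq_measurable_fun (fun _ : profile R n m => 0 : R)) => // v _.
    by rewrite big_nil.
  case: (boolP (is_allocation A)) => aA; last first.
    by apply: eq_measurable_fun IH => v _; rewrite big_cons (negPf aA).
  apply: (eq_measurable_fun (fun v => Num.max (welfare v A)
    (\big[Num.max/0]_(A <- s | is_allocation A) welfare v A))).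
    by move=> v _; rewrite big_cons aA.
  apply: measurable_maxr => //; apply: measurable_welfare => // i S.
  exact: measurable_const_set.
exact: H.
Qed.

(* The roles are encoded by natural numbers, whose sigma-algebra is discrete. *)
Definition seed_sets n (k : nat) : {set 'I_n} * {set 'I_n} :=
  nth (finset.set0, finset.set0) (enum {: {set 'I_n} * {set 'I_n}}) k.

Lemma sum_seed_sets n (V : nmodType) (F : {set 'I_n} -> {set 'I_n} -> V) :
  \sum_(k < #|{: {set 'I_n} * {set 'I_n}}|)
    F (seed_sets n k).1 (seed_sets n k).2 =
  \sum_(A : {set 'I_n}) \sum_(B : {set 'I_n}) F A B.
Proof.
rewrite pair_big/= -[RHS]big_enum/= (big_nth (finset.set0, finset.set0)) -cardE.
by rewrite big_mkord.
Qed.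

(** * The algorithm and its expected welfare *)

Section algorithm.
Variables (R : realType) (n m : nat).

Definition alloc (k : nat) (s v : profile R n m) : 'I_n -> {set 'I_m} :=
  let: (A, B) := seed_sets n k in bundle (mix (A :|: B)%SET s v) A B.

Lemma alloc_disjoint k s v (i j : 'I_n) : i != j ->
  [disjoint alloc k s v i & alloc k s v j]%B.
Proof. by rewrite /alloc; case: seed_sets => A B; exact: bundle_disjoint. Qed.

Lemma alloc_online k s (v v' : profile R n m) (i : 'I_n) :
  (forall j : 'I_n, (j <= i)%N -> tnth v j = tnth v' j) ->
  alloc k s v i = alloc k s v' i.
Proof.
rewrite /alloc; case: seed_sets => A B vv'; apply: bundle_eq => j.
by rewrite !tnth_mix inE orbA; case: ifP => //= _; exact: vv'.
Qed.

Lemma measurable_alloc (i : 'I_n) (S : {set 'I_m}) :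
  measurable [set x : nat * profile R n m * profile R n m |
    alloc x.1.1 x.1.2 x.2 i = S].
Proof.
pose T : Type := (nat * profile R n m * profile R n m)%type.
rewrite (_ : [set _ | _] = \bigcup_k ((fun x : T => x.1.1) @^-1` [set k] `&`
    (fun x : T => alloc k x.1.2 x.2) @^-1` [set f | f i = S])); last first.
  apply/seteqP; split=> x /=; first by move=> xS; exists x.1.1.
  by move=> [k _ [/= -> ]].
apply: bigcupT_measurable => k; apply: measurableI.
  rewrite -[X in measurable X]setTI.
  exact: (measurableT_comp measurable_fst measurable_fst).
rewrite /alloc; case: seed_sets => A B /=.
have mX : measurable_fun setT (fun x : nat * profile R n m * profile R n m =>
    mixp (A :|: B)%SET (x.1.2, x.2)).
  apply: measurableT_comp => //.
  apply: measurable_fun_pair => //.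
  exact: (measurableT_comp measurable_snd measurable_fst).
have := mX measurableT _ (measurable_bundle A B i S); rewrite setTI; exact.
Qed.

Definition algorithm : online_algorithm R n m :=
  @OnlineAlgorithm R n m _ nat
    (uniform_nat R #|{: {set 'I_n} * {set 'I_n}}|.-1)
    alloc alloc_disjoint alloc_online measurable_alloc.

(* Only buyers outside A :|: B receive items, and for these mix s v is v. *)
Lemma welfare_alloc k (s v : profile R n m) :
  welfare v (alloc k s v) =
  let: (A, B) := seed_sets n k in
  welfare (mix (A :|: B)%SET s v) (bundle (mix (A :|: B)%SET s v) A B).
Proof.
rewrite /alloc; case: seed_sets => A B; apply: eq_bigr => i _.
set S := bundle _ _ _ _; rewrite tnth_mix inE.
case: ifP => // iAB; suff -> : S = finset.set0 by rewrite !val_set0.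
apply/setP => j; rewrite !inE; apply/negP => /andP[/and3P[iA iB _] _].
by move: iAB; rewrite (negPf iA) (negPf iB).
Qed.

Variables (D_ : 'I_n -> probability (xos_valuation R m) R)
  (D : probability (profile R n m) R).
Hypothesis D_product : is_product_distribution D_ D.

Lemma measurable_welfare_bundle (A B : {set 'I_n}) : measurable_fun setT
  (fun w : profile R n m => (welfare w (bundle w A B))%:E).
Proof.
apply/measurable_EFinP; apply: measurable_welfare => // i S.
exact: measurable_bundle.
Qed.

Lemma integral_mix (C : {set 'I_n}) (f : profile R n m -> \bar R) :
  measurable_fun setT f -> (forall w, 0 <= f w)%E ->
  (\int[D]_s \int[D]_v f (mix C s v) = \int[D]_w f w)%E.
Proof.
move=> mf f0.
rewrite -(fubini_tonelli1 (f \o mixp C)); last 2 first.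
- exact: measurableT_comp.
- by move=> x; exact: f0.
rewrite -(ge0_integral_distribution (mixp C)) //.
by apply: eq_measure_integral => X mX _; exact: (distribution_mix D_product).
Qed.

(** For fixed roles, [integral_mix] merges samples and valuations into one profile of law [D]; the
    uniform seed averages over the roles. *)
Lemma expected_alg_welfareE : expected_alg_welfare algorithm D =
  (((#|{set 'I_n}| * #|{set 'I_n}|)%:R^-1)%:E *
    \sum_(A : {set 'I_n}) \sum_(B : {set 'I_n})
      \int[D]_w (welfare w (bundle w A B))%:E)%E.
Proof.
rewrite /expected_alg_welfare unlock.
set f := (X in integral _ _ X).
have f0 x : (0 <= f x)%E by rewrite lee_fin welfare_ge0.
have mf : measurable_fun setT f.
  apply/measurable_EFinP; apply: measurable_welfare => //.
  exact: measurable_alloc.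
rewrite fubini_tonelli1//; set F := fubini_F _ _.
have F0 x : (0 <= F x)%E by apply: integral_ge0 => v _; exact: f0.
have mF : measurable_fun setT F by exact: measurable_fun_fubini_tonelli_F.
rewrite fubini_tonelli1// integral_uniform_nat; last first.
  by move=> k; apply: integral_ge0 => s _; exact: F0.
have N0 : (0 < #|{: {set 'I_n} * {set 'I_n}}|)%N.
  by apply/card_gt0P; exists (finset.set0, finset.set0).
rewrite prednK// -card_prod; congr (_ * _)%E.
rewrite -sum_seed_sets; apply: eq_bigr => k _.
transitivity (\int[D]_s \int[D]_v (let: (A, B) := seed_sets n k in
    welfare (mix (A :|: B)%SET s v) (bundle (mix (A :|: B)%SET s v) A B))%:E)%E.
  apply: eq_integral => s _; apply: eq_integral => v _.
  by rewrite -welfare_alloc.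
case: seed_sets => A B /=.
apply: (@integral_mix (A :|: B)%SET (fun w => (welfare w (bundle w A B))%:E)).
- exact: measurable_welfare_bundle.
- by move=> w; rewrite lee_fin welfare_ge0.
Qed.

(** Both sides are integrals over a single profile, and [optimal_welfare_le] compares the integrands
    pointwise. *)
Lemma expected_optimal_welfare_le :
  ((1 / 160)%:E * expected_optimal_welfare D <=
    expected_alg_welfare algorithm D)%E.
Proof.
rewrite expected_alg_welfareE /expected_optimal_welfare unlock.
have W0 A B (w : profile R n m) : (0 <= (welfare w (bundle w A B))%:E)%E.
  by rewrite lee_fin welfare_ge0.
have O0 (w : profile R n m) : (0 <= (optimal_welfare w)%:E)%E.
  by rewrite lee_fin optimal_welfare_ge0.
have mO : measurable_fun setT (fun w : profile R n m => (optimal_welfare w)%:E).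
  by apply/measurable_EFinP; exact: measurable_optimal_welfare.
have mW A B := measurable_welfare_bundle A B.
have mW2 A : measurable_fun setT (fun w : profile R n m =>
    \sum_(B : {set 'I_n}) (welfare w (bundle w A B))%:E)%E.
  by apply: emeasurable_sum.
under eq_bigr do rewrite -ge0_integral_sum//.
rewrite -ge0_integral_sum//; last by move=> A w _; apply: sume_ge0.
have mS : measurable_fun setT (fun w : profile R n m =>
    \sum_(A : {set 'I_n}) \sum_(B : {set 'I_n})
      (welfare w (bundle w A B))%:E)%E.
  by apply: emeasurable_sum.
rewrite -!ge0_integralZl//; last first.
  by move=> w _; apply: sume_ge0 => A _; apply: sume_ge0.
apply: ge0_le_integral => //.
- by move=> w _; rewrite mule_ge0.
- exact: measurable_funeM.
- exact: measurable_funeM.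
move=> w _; under eq_bigr do rewrite sumEFin.
rewrite sumEFin -!EFinM lee_fin.
have := optimal_welfare_le w; set N := (_ * _)%:R => NW.
have N0 : 0 < N :> R.
  by rewrite ltr0n muln_gt0 andbb; apply/card_gt0P; exists finset.set0.
rewrite -(ler_pM2l N0) mulrA mulrCA mulrA mulrC mulrA.
rewrite mulfV ?gt_eqF// mul1r; move: NW; lra.
Qed.

End algorithm.

Theorem theorem1p1 (R : realType) :
  exists (c : R) (ALG : forall n m : nat, online_algorithm R n m),
    1 <= c /\
    forall (n m : nat), (1 <= n)%N -> (1 <= m)%N ->
    forall (D_ : 'I_n -> probability (xos_valuation R m) R)
           (D : probability (profile R n m) R),
      is_product_distribution D_ D ->
      ((1 / c)%:E * expected_optimal_welfare D
         <= expected_alg_welfare (ALG n m) D)%E.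
Proof.
exists 160, (algorithm R); split; first by lra.
move=> n m _ _ D_ D D_product; exact: expected_optimal_welfare_le D_product.
Qed.
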